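(* Let $F:(M,I,J,K,g_M)\to(N,g_N)$ be an h-semi-slant Riemannian map from a hyperkähler manifold to a Riemannian manifold such that $(I,J,K)$ is an h-semi-slant basis, with associated orthogonal decomposition $\ker F_*=\mathcal{D}_1\oplus\mathcal{D}_2$. Then the following conditions are equivalent: a) the (complex) distribution $\mathcal{D}_1$ is integrable; b) $Q_I(\widehat{\nabla}_X\phi_I Y-\widehat{\nabla}_Y\phi_I X)=0$ and $\mathcal{T}_X\phi_I Y=\mathcal{T}_Y\phi_I X$ for all $X,Y\in\Gamma(\mathcal{D}_1)$; c) $Q_J(\widehat{\nabla}_X\phi_J Y-\widehat{\nabla}_Y\phi_J X)=0$ and $\mathcal{T}_X\phi_J Y=\mathcal{T}_Y\phi_J X$ for all $X,Y\in\Gamma(\mathcal{D}_1)$; d) $Q_K(\widehat{\nabla}_X\phi_K Y-\widehat{\nabla}_Y\phi_K X)=0$ and $\mathcal{T}_X\phi_K Y=\mathcal{T}_Y\phi_K X$ for all $X,Y\in\Gamma(\mathcal{D}_1)$.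
   Context: All manifolds and maps are $C^\infty$; $\Gamma(\cdot)$ denotes smooth sections. A hyperkähler manifold $(M,I,J,K,g_M)$ is a Riemannian manifold with globally defined endomorphism fields $I,J,K$ of $TM$, each parallel for the Levi-Civita connection $\nabla$ of $g_M$, satisfying $I^2=J^2=K^2=-\mathrm{id}$, $IJ=-JI=K$, $JK=-KJ=I$, $KI=-IK=J$, and $g_M(RX,RY)=g_M(X,Y)$ for $R\in\{I,J,K\}$. A map $F:(M,g_M)\to(N,g_N)$ is a Riemannian map if for every $p\in M$ the differential $(F_* )_p$ restricted to $(\ker (F_* )_p)^\perp$ is a linear isometry onto the image of $(F_* )_p$ (with metric induced from $g_N$). Elements of $\Gamma(\ker F_* )$ are called vertical, elements of $\Gamma((\ker F_* )^\perp)$ horizontal. $F$ is an h-semi-slant Riemannian map with h-semi-slant basis $(I,J,K)$ if it is a Riemannian map and there is a distribution $\mathcal{D}_1\subset\ker F_*$ such that, with $\mathcal{D}_2$ the orthogonal complement of $\mathcal{D}_1$ in $\ker F_*$, for every $R\in\{I,J,K\}$ one has $R(\mathcal{D}_1)=\mathcal{D}_1$ and the angle $\theta_R$ between $RX$ and the space $(\mathcal{D}_2)_q$ is constant for all nonzero $X\in(\mathcal{D}_2)_q$ and all $q$. For $R\in\{I,J,K\}$: for $X\in\Gamma(\ker F_* )$ write $X=P_RX+Q_RX$ with $P_RX\in\Gamma(\mathcal{D}_1)$, $Q_RX\in\Gamma(\mathcal{D}_2)$, and $RX=\phi_RX+\omega_RX$ with $\phi_RX$ vertical and $\omega_RX$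 horizontal. Let $\mathcal{V},\mathcal{H}$ be the orthogonal projections of $TM$ onto $\ker F_*$ and $(\ker F_* )^\perp$. Define $\mathcal{T}_{E}G=\mathcal{H}\nabla_{\mathcal{V}E}\mathcal{V}G+\mathcal{V}\nabla_{\mathcal{V}E}\mathcal{H}G$ for $E,G\in\Gamma(TM)$, and $\widehat{\nabla}_XY=\mathcal{V}\nabla_XY$ for $X,Y\in\Gamma(\ker F_* )$. *)

(* Defs.v *)
From mathcomp Require Import all_boot all_order all_algebra.
From mathcomp Require Import all_classical all_reals all_analysis.

Set Implicit Arguments.
Unset Strict Implicit.
Unset Printing Implicit Defensive.

Import Order.TTheory GRing.Theory Num.Theory.
Import numFieldNormedType.Exports.

Local Open Scope classical_set_scope.
Local Open Scope ring_scope.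

(** * Smooth functions on open subsets of R^m *)

(* Meaningful for [U] open: all iterated partial derivatives of [f] up to order
   [k] exist and are continuous at the points of [U]. *)
Fixpoint Ck {R : realType} {m : nat} {W : normedModType R} (k : nat)
    (U : set 'rV[R]_m) (f : 'rV[R]_m -> W) : Prop :=
  (forall x, U x -> {for x, continuous f}) /\
  if k is k'.+1 then
    forall i : 'I_m,
      (forall x, U x -> derivable f x (delta_mx 0 i)) /\
      Ck k' U (fun x => 'D_(delta_mx 0 i) f x)
  else True.

Definition smooth_on {R : realType} {m : nat} {W : normedModType R}
    (U : set 'rV[R]_m) (f : 'rV[R]_m -> W) : Prop :=
  forall k, Ck k U f.

(** * Manifolds *)

Record chart (R : realType) (m : nat) (M : topologicalType) := Chart {
  chart_dom : set M;
  chart_map :> M -> 'rV[R]_m;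
  chart_inv : 'rV[R]_m -> M;
  chart_cod := chart_map @` chart_dom;
  _ : open chart_dom;
  _ : open chart_cod;
  _ : forall p, chart_dom p -> chart_inv (chart_map p) = p;
  _ : forall p, chart_dom p -> {for p, continuous chart_map};
  _ : forall x, chart_cod x -> {for x, continuous chart_inv}
}.

(* The atlas is indexed by the points of the manifold; any smooth atlas yields
   one of this form, by choosing a chart around each point. The chosen chart at
   [p] also serves to identify the tangent space at [p] with R^m. *)
Record manifold (R : realType) (m : nat) := Manifold {
  carrier :> topologicalType;
  chart_at : carrier -> chart R m carrier;
  _ : hausdorff_space carrier;
  _ : second_countable (T := carrier);
  _ : forall p, chart_dom (chart_at p) p;
  _ : forall p q,
      smooth_on (chart_at p @` (chart_dom (chart_at p) `&` chart_dom (chart_at q)))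
                (chart_at q \o chart_inv (chart_at p))
}.

Definition smooth_fun {R : realType} {m : nat} {M : manifold R m}
    (U : set M) (f : M -> R) : Prop :=
  forall q : M,
    smooth_on (chart_cod (chart_at q) `&` chart_inv (chart_at q) @^-1` U)
              (f \o chart_inv (chart_at q)).

Definition smooth_map {R : realType} {m n : nat}
    {M : manifold R m} {N : manifold R n} (F : M -> N) : Prop :=
  continuous F /\
  forall (p : M) (q : N),
    smooth_on
      (chart_cod (chart_at p)
         `&` (F \o chart_inv (chart_at p)) @^-1` chart_dom (chart_at q))
      (chart_at q \o F \o chart_inv (chart_at p)).

(* Matrix of the differential of [F] at [p] with respect to the charts at [p]
   and at [F p]; it acts on row vectors: F_* v is [v *m dmap F p]. *)
Definition dmap {R : realType} {m n : nat}
    {M : manifold R m} {N : manifold R n} (F : M -> N) (p : M) : 'M[R]_(m, n) :=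
  jacobian (chart_at (F p) \o F \o chart_inv (chart_at p)) (chart_at p p).

(** * Vector fields *)

(* A not necessarily smooth section of TM: [X p] is the row of components of a
   tangent vector at [p] in the chart [chart_at p]. *)
Definition vfield {R : realType} {m : nat} (M : manifold R m) := M -> 'rV[R]_m.

(* Components in the chart at [q] of the tangent vector [v] at [p]. *)
Definition tcoord {R : realType} {m : nat} {M : manifold R m}
    (q p : M) (v : 'rV[R]_m) : 'rV[R]_m :=
  'd (chart_at q \o chart_inv (chart_at p)) (chart_at p p) v.

Definition in_chart {R : realType} {m : nat} {M : manifold R m}
    (q : M) (X : vfield M) (x : 'rV[R]_m) : 'rV[R]_m :=
  tcoord q (chart_inv (chart_at q) x) (X (chart_inv (chart_at q) x)).

Definition smooth_vfield {R : realType} {m : nat} {M : manifold R m}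
    (U : set M) (X : vfield M) : Prop :=
  forall q : M,
    smooth_on (chart_cod (chart_at q) `&` chart_inv (chart_at q) @^-1` U)
              (in_chart q X).

(* The function X(f). *)
Definition lie_derive {R : realType} {m : nat} {M : manifold R m}
    (X : vfield M) (f : M -> R) (p : M) : R :=
  'd (f \o chart_inv (chart_at p)) (chart_at p p) (X p).

(* [X, Y]^i = X^j d_j Y^i - Y^j d_j X^i, computed at [p] in the chart at [p]. *)
Definition bracket {R : realType} {m : nat} {M : manifold R m}
    (X Y : vfield M) : vfield M := fun p =>
  'd (in_chart p Y) (chart_at p p) (X p) - 'd (in_chart p X) (chart_at p p) (Y p).

(** * Fields of endomorphisms and distributions *)

(* Endomorphisms act on row vectors on the right, so that the composite
   [A] after [B] has matrix [B p *m A p]. *)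
Definition efield {R : realType} {m : nat} (M : manifold R m) := M -> 'M[R]_m.

Definition eapp {R : realType} {m : nat} {M : manifold R m}
    (E : efield M) (X : vfield M) : vfield M := fun p => X p *m E p.

Definition smooth_efield {R : realType} {m : nat} {M : manifold R m}
    (E : efield M) : Prop :=
  forall (U : set M) (X : vfield M),
    open U -> smooth_vfield U X -> smooth_vfield U (eapp E X).

(* A field of subspaces of the tangent spaces: the subspace at [p] is the row
   space of [D p]. *)
Definition subspaces {R : realType} {m : nat} (M : manifold R m) := M -> 'M[R]_m.

(* Smooth subbundles of TM; the rank is locally constant. *)
Definition distribution {R : realType} {m : nat} {M : manifold R m}
    (D : subspaces M) : Prop :=
  forall p : M, exists (U : set M) (k : nat) (e : 'I_k -> vfield M),
    [/\ open U, U p, forall i, smooth_vfield U (e i) &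
        forall q, U q ->
          row_free (\matrix_i e i q) /\ (D q :=: \matrix_i e i q)%MS].

(* Gamma(D) *)
Definition section_of {R : realType} {m : nat} {M : manifold R m}
    (D : subspaces M) (X : vfield M) : Prop :=
  smooth_vfield setT X /\ forall p, (X p <= D p)%MS.

(* Integrability is understood as closure of Gamma(D) under the Lie bracket;
   the bracket of smooth fields is smooth, so only membership is required. *)
Definition integrable_distribution {R : realType} {m : nat} {M : manifold R m}
    (D : subspaces M) : Prop :=
  forall X Y : vfield M, section_of D X -> section_of D Y ->
    forall p, (bracket X Y p <= D p)%MS.

Definition ker_d {R : realType} {m n : nat}
    {M : manifold R m} {N : manifold R n} (F : M -> N) : subspaces M :=
  fun p => kermx (dmap F p).

(** * Riemannian metrics *)

Definition inner {R : realType} {m : nat} (G : 'M[R]_m) (u v : 'rV[R]_m) : R :=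
  (u *m G *m v^T) 0 0.

(* [g p] is the Gram matrix of the metric at [p] in the chart at [p]. *)
Record riemannian_metric {R : realType} {m : nat} (M : manifold R m) := Metric {
  metric_at :> M -> 'M[R]_m;
  _ : forall p, (metric_at p)^T = metric_at p;
  _ : forall p (v : 'rV[R]_m), v != 0 -> 0 < inner (metric_at p) v v;
  _ : forall (U : set M) (X Y : vfield M),
      open U -> smooth_vfield U X -> smooth_vfield U Y ->
      smooth_fun U (fun p => inner (metric_at p) (X p) (Y p))
}.

Definition ocompl {R : realType} {m : nat} {M : manifold R m}
    (g : riemannian_metric M) (D : subspaces M) : subspaces M :=
  fun p => orthomx idfun (g p) (D p).

Definition oproj {R : realType} {m : nat} {M : manifold R m}
    (g : riemannian_metric M) (D : subspaces M) : efield M :=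
  fun p => proj_mx (D p) (ocompl g D p).

(* Angle between the nonzero vector [u] and the subspace [D p], that is,
   between [u] and its orthogonal projection on [D p]; it is pi / 2 when this
   projection vanishes. *)
Definition angle {R : realType} {m : nat} {M : manifold R m}
    (g : riemannian_metric M) (D : subspaces M) (p : M) (u : 'rV[R]_m) : R :=
  let norm v := Num.sqrt (inner (g p) v v) in
  acos (norm (u *m oproj g D p) / norm u).

(* An affine connection acts on smooth fields; its value on other fields is
   irrelevant. *)
Definition connection {R : realType} {m : nat} (M : manifold R m) :=
  vfield M -> vfield M -> vfield M.

Record levi_civita {R : realType} {m : nat} {M : manifold R m}
    (g : riemannian_metric M) (nabla : connection M) : Prop := LeviCivita {
  _ : forall X Y, smooth_vfield setT X -> smooth_vfield setT Y ->
      smooth_vfield setT (nabla X Y);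
  _ : forall f X X' Y, smooth_fun setT f -> smooth_vfield setT X ->
      smooth_vfield setT X' -> smooth_vfield setT Y ->
      forall p, nabla (fun q => f q *: X q + X' q) Y p
                = f p *: nabla X Y p + nabla X' Y p;
  _ : forall f X Y Y', smooth_fun setT f -> smooth_vfield setT X ->
      smooth_vfield setT Y -> smooth_vfield setT Y' ->
      forall p, nabla X (fun q => f q *: Y q + Y' q) p
                = lie_derive X f p *: Y p + f p *: nabla X Y p + nabla X Y' p;
  _ : forall X Y, smooth_vfield setT X -> smooth_vfield setT Y ->
      forall p, nabla X Y p - nabla Y X p = bracket X Y p;
  _ : forall X Y Z, smooth_vfield setT X -> smooth_vfield setT Y ->
      smooth_vfield setT Z ->
      forall p, lie_derive X (fun q => inner (g q) (Y q) (Z q)) p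
                = inner (g p) (nabla X Y p) (Z p)
                  + inner (g p) (Y p) (nabla X Z p)
}.

(** * Hyperkähler manifolds *)

Definition parallel {R : realType} {m : nat} {M : manifold R m}
    (nabla : connection M) (E : efield M) : Prop :=
  forall X Y, smooth_vfield setT X -> smooth_vfield setT Y ->
    forall p, nabla X (eapp E Y) p = nabla X Y p *m E p.

Record hyperkahler {R : realType} {m : nat} {M : manifold R m}
    (g : riemannian_metric M) (nabla : connection M) (I J K : efield M) : Prop :=
  Hyperkahler {
  _ : levi_civita g nabla;
  _ : [/\ smooth_efield I, smooth_efield J & smooth_efield K];
  _ : [/\ parallel nabla I, parallel nabla J & parallel nabla K];
  _ : forall p, [/\ I p *m I p = - 1%:M, J p *m J p = - 1%:M
                  & K p *m K p = - 1%:M];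
  _ : forall p, J p *m I p = K p /\ I p *m J p = - K p;
  _ : forall p, K p *m J p = I p /\ J p *m K p = - I p;
  _ : forall p, I p *m K p = J p /\ K p *m I p = - J p;
  _ : forall p u v, [/\ inner (g p) (u *m I p) (v *m I p) = inner (g p) u v,
                        inner (g p) (u *m J p) (v *m J p) = inner (g p) u v
                      & inner (g p) (u *m K p) (v *m K p) = inner (g p) u v]
}.

(** * Riemannian maps *)

Definition riemannian_map {R : realType} {m n : nat}
    {M : manifold R m} {N : manifold R n}
    (gM : riemannian_metric M) (gN : riemannian_metric N) (F : M -> N) : Prop :=
  smooth_map F /\
  forall p u v,
    (u <= ocompl gM (ker_d F) p)%MS -> (v <= ocompl gM (ker_d F) p)%MS ->
    inner (gN (F p)) (u *m dmap F p) (v *m dmap F p) = inner (gM p) u v.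

(* The orthogonal complement of [D1] in ker F_*. *)
Definition compl_in_ker {R : realType} {m n : nat}
    {M : manifold R m} {N : manifold R n}
    (gM : riemannian_metric M) (F : M -> N) (D1 : subspaces M) : subspaces M :=
  fun p => (ocompl gM D1 p :&: ker_d F p)%MS.

Definition semi_slant_for {R : realType} {m : nat} {M : manifold R m}
    (g : riemannian_metric M) (D1 D2 : subspaces M) (E : efield M) : Prop :=
  (forall p, (D1 p *m E p :=: D1 p)%MS) /\
  exists theta : R, forall p (v : 'rV[R]_m),
    (v <= D2 p)%MS -> v != 0 -> angle g D2 p (v *m E p) = theta.

Definition h_semi_slant {R : realType} {m n : nat}
    {M : manifold R m} {N : manifold R n}
    (gM : riemannian_metric M) (gN : riemannian_metric N) (I J K : efield M)
    (F : M -> N) (D1 : subspaces M) : Prop :=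
  let D2 := compl_in_ker gM F D1 in
  [/\ riemannian_map gM gN F,
      distribution D1,
      forall p, (D1 p <= ker_d F p)%MS
    & [/\ semi_slant_for gM D1 D2 I, semi_slant_for gM D1 D2 J
        & semi_slant_for gM D1 D2 K]].

(** * The operators associated with an h-semi-slant Riemannian map *)

Definition ver {R : realType} {m n : nat} {M : manifold R m} {N : manifold R n}
    (gM : riemannian_metric M) (F : M -> N) : vfield M -> vfield M :=
  eapp (oproj gM (ker_d F)).

Definition hor {R : realType} {m n : nat} {M : manifold R m} {N : manifold R n}
    (gM : riemannian_metric M) (F : M -> N) : vfield M -> vfield M :=
  eapp (oproj gM (ocompl gM (ker_d F))).

(* phi_E X, the vertical part of E X. *)
Definition phi {R : realType} {m n : nat} {M : manifold R m} {N : manifold R n}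
    (gM : riemannian_metric M) (F : M -> N) (E : efield M) (X : vfield M) :
    vfield M :=
  ver gM F (eapp E X).

(* The D2-component of a vertical field in ker F_* = D1 + D2. This is Q_I, Q_J
   and Q_K alike, as D1 and D2 are the same for I, J and K. *)
Definition Qproj {R : realType} {m n : nat} {M : manifold R m} {N : manifold R n}
    (gM : riemannian_metric M) (F : M -> N) (D1 : subspaces M) :
    vfield M -> vfield M :=
  eapp (fun p => proj_mx (compl_in_ker gM F D1 p) (D1 p)).

Definition tensorT {R : realType} {m n : nat}
    {M : manifold R m} {N : manifold R n} (gM : riemannian_metric M)
    (nabla : connection M) (F : M -> N) (E G : vfield M) : vfield M := fun p =>
  hor gM F (nabla (ver gM F E) (ver gM F G)) p
  + ver gM F (nabla (ver gM F E) (hor gM F G)) p.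

Definition nabla_hat {R : realType} {m n : nat}
    {M : manifold R m} {N : manifold R n} (gM : riemannian_metric M)
    (nabla : connection M) (F : M -> N) (X Y : vfield M) : vfield M :=
  ver gM F (nabla X Y).

(* Main.v *)
Require Import Defs.
From mathcomp Require Import all_boot all_order all_algebra.
From mathcomp Require Import all_classical all_reals all_analysis.

(** Everything rests on one computation. Let [E] be [I], [J] or [K]
    and let [X], [Y] be sections of [D1]. As [E] preserves [D1], which lies in
    the kernel of [F_*], the field [E Y] is vertical: [phi_E Y = E Y], and the
    horizontal part of [E Y] vanishes. As [E] is parallel and the Levi-Civita
    connection has no torsion,
      [nabla_X (E Y) - nabla_Y (E X) = E (nabla_X Y - nabla_Y X) = E [X, Y]].
    Hence the two equations of the condition attached to [E] say that
    [Q (V (E [X, Y])) = 0] and [H (E [X, Y]) = 0], where [V] and [H] are the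
    vertical and horizontal projections: the second one says that [E [X, Y]] is
    vertical, and then the first one that it lies in [D1] (lemma
    [vertical_horizontal_parts_eq0]). Finally [E [X, Y]] lies in [D1] if and
    only if [[X, Y]] does, because [E] is an invertible endomorphism preserving
    [D1]. So the condition attached to each of the three structures is
    separately equivalent to integrability (lemma
    [integrable_iff_parallel_structure]).

    The rest is linear algebra in one tangent space: for a positive definite
    Gram matrix, a subspace and its orthogonal complement split the space, and
    the complement of the complement is the subspace itself. *)

Import Order.TTheory GRing.Theory Num.Theory.
Import numFieldNormedType.Exports.

Local Open Scope ring_scope.

(** * Orthogonal complements for a positive definite Gram matrix *)

Section PositiveDefinite.
Context {R : realType} {m : nat} {G : 'M[R]_m}.
Hypothesis symG : G^T = G.
Hypothesis posG : forall v : 'rV[R]_m, v != 0 -> 0 < inner G v v.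

Local Notation "A ^!" := (orthomx idfun G A) : matrix_set_scope.

Lemma sub_orthomxP p q (A : 'M[R]_(p, m)) (B : 'M[R]_(q, m)) :
  reflect (A *m G *m B^T = 0) (A <= B^!)%MS.
Proof.
rewrite /orthomx map_mx_id //.
by apply: (iffP sub_kermxP); rewrite mulmxA.
Qed.

Lemma orthomxC p q (A : 'M[R]_(p, m)) (B : 'M[R]_(q, m)) :
  (A <= B^!)%MS -> (B <= A^!)%MS.
Proof.
move=> /sub_orthomxP AB0; apply/sub_orthomxP.
by apply: trmx_inj; rewrite !trmx_mul trmxK symG mulmxA AB0 trmx0.
Qed.

Lemma capmx_orthomx p (A : 'M[R]_(p, m)) : (A :&: A^! = 0)%MS.
Proof.
apply/eqP; rewrite -submx0; apply/rV_subP => v.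
rewrite sub_capmx => /andP[vA vAo]; rewrite submx0.
apply/negPn/negP => /posG; rewrite /inner.
have /sub_orthomxP -> := submx_trans vA (orthomxC _ _ _ _ vAo).
by rewrite mxE ltxx.
Qed.

(** [A^!] is cut out by at most [\rank A] equations, so its dimension is at
    least [m - \rank A]; since it is disjoint from [A], the sum is everything. *)
Lemma addsmx_orthomx q p (A : 'M[R]_(p, m)) (B : 'M[R]_(q, m)) :
  (B <= A + A^!)%MS.
Proof.
apply: submx_full; rewrite /row_full eqn_leq rank_leq_col.
rewrite (mxrank_disjoint_sum (capmx_orthomx _ A)) mxrank_ker -leq_subLR.
rewrite leq_sub2l // (leq_trans (mxrankM_maxr _ _)) //.
by rewrite map_mx_id // mxrank_tr.
Qed.

Lemma orthomxK p (A : 'M[R]_(p, m)) : (A^!^! :=: A)%MS.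
Proof.
have sA : (A <= A^!^!)%MS by exact: orthomxC.
apply/eqmxP; rewrite sA andbT.
(* The modular law: A^!^! = (A + A^!) :&: A^!^! = A + (A^! :&: A^!^!). *)
apply: submx_trans (_ : (A^!^! <= (A + A^!) :&: A^!^!)%MS) _.
  by rewrite sub_capmx addsmx_orthomx submx_refl.
by rewrite -(matrix_modl _ sA) capmx_orthomx addsmx0.
Qed.

End PositiveDefinite.

(** * Smooth constants and the zero field *)

Lemma Ck_cst {R : realType} {m : nat} {W : normedModType R} (k : nat)
    (U : set 'rV[R]_m) (c : W) : Ck k U (fun _ => c).
Proof.
elim: k c => [|k IHk] c; split=> //; try by move=> x _; exact: cst_continuous.
move=> i; split; first by move=> x _; exact: derivable_cst.
rewrite (_ : 'D__ _ = fun _ => 0); first exact: IHk.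
by apply/funext => x; rewrite derive_cst.
Qed.

Lemma smooth_fun_cst {R : realType} {m : nat} {M : manifold R m}
    (U : set M) (c : R) : smooth_fun U (fun _ => c).
Proof. by move=> q k; exact: Ck_cst. Qed.

Lemma smooth_vfield0 {R : realType} {m : nat} {M : manifold R m} (U : set M) :
  smooth_vfield U (fun _ => 0 : 'rV[R]_m).
Proof.
move=> q k; rewrite (_ : in_chart _ _ = fun _ => 0); first exact: Ck_cst.
by apply/funext => x; rewrite /in_chart /tcoord linear0.
Qed.

(** This removes the term [V (nabla_X (H G))] of [T_X G] when the field [G] is
    vertical. *)
Lemma levi_civita0 {R : realType} {m : nat} {M : manifold R m}
    {g : riemannian_metric M} {nabla : connection M} (X : vfield M) (p : M) :
  levi_civita g nabla -> smooth_vfield setT X -> nabla X (fun _ => 0) p = 0.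
Proof.
case=> _ _ leibniz _ _ smX.
(* The Leibniz rule for the field 0 = 1 0 + 0. *)
have := leibniz _ _ _ _ (smooth_fun_cst setT 1) smX
  (smooth_vfield0 setT) (smooth_vfield0 setT) p.
rewrite (_ : (fun _ => 1 *: 0 + 0) = fun _ : M => 0); last first.
  by apply/funext => q; rewrite scaler0 addr0.
rewrite scaler0 add0r scale1r => /esym/eqP.
by rewrite -subr_eq0 addrK => /eqP.
Qed.

(** * Orthogonal projections of a Riemannian metric *)

Section Projections.
Context {R : realType} {m : nat} {M : manifold R m}.
Variable g : riemannian_metric M.

Lemma metric_sym p : (g p)^T = g p.
Proof. by case: g. Qed.

Lemma metric_pos p (v : 'rV[R]_m) : v != 0 -> 0 < inner (g p) v v.
Proof. by case: g => ? /= _ pos _; exact: pos. Qed.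

Lemma oproj_id (D : subspaces M) p (v : 'rV[R]_m) :
  (v <= D p)%MS -> v *m oproj g D p = v.
Proof. exact: proj_mx_id (capmx_orthomx (metric_sym p) (@metric_pos p) _ _). Qed.

(** The kernel of the projection on [ocompl g D] is the orthogonal complement of
    [ocompl g D], that is, [D]. *)
Lemma oproj_ocompl_eq0 (D : subspaces M) p (v : 'rV[R]_m) :
  v *m oproj g (ocompl g D) p = 0 <-> (v <= D p)%MS.
Proof.
have dx := capmx_orthomx (metric_sym p) (@metric_pos p) _ (ocompl g D p).
rewrite -(orthomxK (metric_sym p) (@metric_pos p) _ (D p)).
split=> [v0|]; last exact: proj_mx_0 dx.
rewrite -[v]subr0 -v0; apply: proj_mx_compl_sub.
exact: addsmx_orthomx (metric_sym p) (@metric_pos p) _ _ _ _.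
Qed.

Section InKernel.
Context {n : nat} {N : manifold R n} (F : M -> N) (D1 : subspaces M).
Hypothesis D1_ker : forall p, (D1 p <= ker_d F p)%MS.

(** The modular law gives [ker F_* = (D1 + D1^!) :&: ker F_* = D1 + D2]. On this
    direct sum the projection on [D2] along [D1] has kernel [D1]; outside of it
    nothing can be said, hence the condition on [v]. *)
Lemma proj_compl_in_ker_eq0 p (v : 'rV[R]_m) : (v <= ker_d F p)%MS ->
  v *m proj_mx (compl_in_ker g F D1 p) (D1 p) = 0 <-> (v <= D1 p)%MS.
Proof.
move=> v_ker.
have dx : (compl_in_ker g F D1 p :&: D1 p = 0)%MS.
  apply/eqP; rewrite -submx0.
  rewrite -(capmx_orthomx (metric_sym p) (@metric_pos p) _ (D1 p)) capmxC.
  exact: capmxS (submx_refl _) (capmxSl _ _).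
split=> [v0|]; last exact: proj_mx_0 dx.
rewrite -[v]subr0 -v0; apply: proj_mx_compl_sub.
rewrite addsmxC (matrix_modl _ (D1_ker p)) sub_capmx v_ker andbT.
exact: addsmx_orthomx (metric_sym p) (@metric_pos p) _ _ _ _.
Qed.

(** The two equations are read in the order opposite to the one in which they are
    written: the projection on [D2] detects [D1] only among vertical vectors, and
    the vanishing of the horizontal part is what makes [v] vertical. *)
Lemma vertical_horizontal_parts_eq0 p (v : 'rV[R]_m) :
  v *m oproj g (ker_d F) p *m proj_mx (compl_in_ker g F D1 p) (D1 p) = 0 /\
  v *m oproj g (ocompl g (ker_d F)) p = 0 <-> (v <= D1 p)%MS.
Proof.
rewrite oproj_ocompl_eq0; split=> [[Qv0 v_ker]|v_D1].
  by apply/(proj_compl_in_ker_eq0 _ _ v_ker); rewrite -{1}(oproj_id _ _ _ v_ker).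
have v_ker := submx_trans v_D1 (D1_ker p).
by split=> //; rewrite oproj_id //; exact/proj_compl_in_ker_eq0.
Qed.

End InKernel.
End Projections.

(** * Integrability through one parallel complex structure *)

(** [v E] lies in [D] exactly when [v] does, since [v = - (v E) E]. *)
Lemma sub_complex_structure {R : realType} {m : nat} (D E : 'M[R]_m)
    (v : 'rV[R]_m) :
  E *m E = - 1%:M -> (D *m E :=: D)%MS -> (v *m E <= D)%MS = (v <= D)%MS.
Proof.
move=> E2 DE.
have DsubE (u : 'rV[R]_m) : (u <= D)%MS -> (u *m E <= D)%MS.
  by move=> uD; rewrite -DE submxMr.
apply/idP/idP => [/DsubE|/DsubE //].
by rewrite -mulmxA E2 mulmxN mulmx1 eqmx_opp.
Qed.

Section ParallelStructure.
Context {R : realType} {m n : nat} {M : manifold R m} {N : manifold R n}.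
Context {g : riemannian_metric M} {nabla : connection M} {F : M -> N}.
Context {D1 : subspaces M} {E : efield M}.
Hypothesis lc : levi_civita g nabla.
Hypothesis D1_ker : forall p, (D1 p <= ker_d F p)%MS.
Hypothesis smE : smooth_efield E.
Hypothesis parE : parallel nabla E.
Hypothesis E2 : forall p, E p *m E p = - 1%:M.
Hypothesis D1E : forall p, (D1 p *m E p :=: D1 p)%MS.

Lemma section_ker X p : section_of D1 X -> (X p <= ker_d F p)%MS.
Proof. by case=> _ XD1; exact: submx_trans (XD1 p) (D1_ker p). Qed.

Lemma section_eapp X : section_of D1 X -> section_of D1 (eapp E X).
Proof.
case=> smX XD1; split; first exact: smE openT smX.
by move=> p; rewrite /eapp sub_complex_structure.
Qed.

Lemma ver_section X : section_of D1 X -> ver g F X = X.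
Proof.
by move=> X_sec; apply/funext => p; exact/oproj_id/section_ker.
Qed.

Lemma hor_section X : section_of D1 X -> hor g F X = fun _ => 0.
Proof.
by move=> X_sec; apply/funext => p; exact/oproj_ocompl_eq0/section_ker.
Qed.

Lemma phi_section X : section_of D1 X -> phi g F E X = eapp E X.
Proof. by move=> /section_eapp; exact: ver_section. Qed.

Lemma nabla_section X Y p : section_of D1 X -> section_of D1 Y ->
  nabla X (phi g F E Y) p = nabla X Y p *m E p.
Proof. by move=> [smX _] Y_sec; rewrite phi_section // parE //; case: Y_sec. Qed.

Lemma tensorT_section X Y p : section_of D1 X -> section_of D1 Y ->
  tensorT g nabla F X (phi g F E Y) p =
  nabla X Y p *m E p *m oproj g (ocompl g (ker_d F)) p.
Proof.
move=> X_sec Y_sec.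
have EY_sec : section_of D1 (phi g F E Y).
  by rewrite phi_section //; exact: section_eapp.
rewrite /tensorT (ver_section X) // ver_section // (hor_section (phi _ _ _ _)) //.
rewrite /hor /ver /eapp.
rewrite nabla_section // (levi_civita0 _ _ lc); last by case: X_sec.
by rewrite mul0mx addr0.
Qed.

Lemma bracket_section X Y p : section_of D1 X -> section_of D1 Y ->
  nabla X Y p *m E p - nabla Y X p *m E p = bracket X Y p *m E p.
Proof.
move=> [smX _] [smY _]; case: lc => _ _ _ torsion _.
by rewrite -mulmxBl torsion.
Qed.

(** In both equations the difference of the two sides is a projection of
    [E [X, Y]]: the first gives the [D2]-component of its vertical part, the
    second its horizontal part. *)
Lemma integrable_iff_parallel_structure :
  integrable_distribution D1 <->
  forall X Y, section_of D1 X -> section_of D1 Y ->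
    (forall p, Qproj g F D1 (fun q => nabla_hat g nabla F X (phi g F E Y) q
                                    - nabla_hat g nabla F Y (phi g F E X) q) p = 0)
    /\ (forall p, tensorT g nabla F X (phi g F E Y) p
                = tensorT g nabla F Y (phi g F E X) p).
Proof.
have vertE X Y p : section_of D1 X -> section_of D1 Y ->
    nabla_hat g nabla F X (phi g F E Y) p - nabla_hat g nabla F Y (phi g F E X) p
    = bracket X Y p *m E p *m oproj g (ker_d F) p.
  move=> X_sec Y_sec; rewrite /nabla_hat /ver /eapp !nabla_section //.
  by rewrite -mulmxBl bracket_section.
have horE X Y p : section_of D1 X -> section_of D1 Y ->
    tensorT g nabla F X (phi g F E Y) p - tensorT g nabla F Y (phi g F E X) p
    = bracket X Y p *m E p *m oproj g (ocompl g (ker_d F)) p.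
  by move=> X_sec Y_sec; rewrite !tensorT_section // -mulmxBl bracket_section.
split=> [intD1 X Y X_sec Y_sec|condE X Y X_sec Y_sec p].
  suff split0 p : bracket X Y p *m E p *m oproj g (ker_d F) p
                    *m proj_mx (compl_in_ker g F D1 p) (D1 p) = 0 /\
                  bracket X Y p *m E p *m oproj g (ocompl g (ker_d F)) p = 0.
    split=> p; have [Q0 H0] := split0 p; first by rewrite /Qproj /eapp vertE.
    by apply/eqP; rewrite -subr_eq0 horE // H0.
  apply/vertical_horizontal_parts_eq0 => //.
  by rewrite sub_complex_structure //; exact: intD1.
have [/(_ p) Q0 /(_ p) H0] := condE X Y X_sec Y_sec.
rewrite -(sub_complex_structure _ _ _ (E2 p) (D1E p)).
apply/(vertical_horizontal_parts_eq0 g _ _ D1_ker); split.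
  by move: Q0; rewrite /Qproj /eapp vertE.
by rewrite -horE // H0 subrr.
Qed.

End ParallelStructure.

Theorem theorem3p4 (R : realType) (m n : nat)
    (M : manifold R m) (N : manifold R n)
    (gM : riemannian_metric M) (gN : riemannian_metric N)
    (nabla : connection M) (I J K : efield M)
    (F : M -> N) (D1 : subspaces M) :
  hyperkahler gM nabla I J K ->
  h_semi_slant gM gN I J K F D1 ->
  let Q := Qproj gM F D1 in
  let hat := nabla_hat gM nabla F in
  let T := tensorT gM nabla F in
  let cond (E : efield M) :=
    forall X Y : vfield M, section_of D1 X -> section_of D1 Y ->
      (forall p, Q (fun q => hat X (phi gM F E Y) q - hat Y (phi gM F E X) q) p = 0)
      /\ (forall p, T X (phi gM F E Y) p = T Y (phi gM F E X) p) in
  [<-> integrable_distribution D1; cond I; cond J; cond K].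
Proof.
case=> lc [smI smJ smK] [parI parJ parK] sq _ _ _ _.
case=> _ _ D1_ker [[D1I _] [D1J _] [D1K _]] Q hat T cond.
have condP E : smooth_efield E -> parallel nabla E ->
    (forall p, E p *m E p = - 1%:M) -> (forall p, D1 p *m E p :=: D1 p)%MS ->
    integrable_distribution D1 <-> cond E.
  exact: integrable_iff_parallel_structure.
have intI : integrable_distribution D1 <-> cond I.
  by apply: condP => // p; case: (sq p).
have intJ : integrable_distribution D1 <-> cond J.
  by apply: condP => // p; case: (sq p).
have intK : integrable_distribution D1 <-> cond K.
  by apply: condP => // p; case: (sq p).
tfae; tauto.
Qed.
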